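(* Let $X$ and $Y$ be random variables with probability density functions $f$ and $g$ respectively, both supported on $(0,\infty)$ (i.e. $\{x: f(x)>0\}=\{x: g(x)>0\}=(0,\infty)$). Assume that the log density ratio $l(x)=\log(f(x)/g(x))$, $x>0$, is continuous and moreover concave on $(0,\infty)$, i.e. $X\leq_{lc}Y$. Then: 1. $X\leq_{st}Y$ and $X\leq_{hr}Y$ are equivalent, and each holds if and only if $\lim_{x\downarrow 0} l(x)\geq 0$. 2. Assuming in addition that $l(x)$ is continuously differentiable on $(0,\infty)$, $X\leq_{lr}Y$ and $X\leq_{rh}Y$ are equivalent, and each holds if and only if $\lim_{x\downarrow 0} l'(x)\leq 0$.
   Context: Let $X,Y$ have pdfs $f,g$ and cumulative distribution functions $F,G$, and put $\bar F=1-F$, $\bar G=1-G$. Usual stochastic order: $X\leq_{st}Y$ if $\bar F(x)\leq\bar G(x)$ for all $x$. Hazard rate order: $X\leq_{hr}Y$ if $f(x)/\bar F(x)\geq g(x)/\bar G(x)$ for all $x$ in the common support $(0,\infty)$. Reversed hazard rate order: $X\leq_{rh}Y$ if $f(x)/F(x)\leq g(x)/G(x)$ for all $x$ in the common support $(0,\infty)$. Likelihood ratio order: $X\leq_{lr}Y$ if $f(x)/g(x)$ is a monotone decreasing (i.e. non-increasing) function on $\{x: f(x)>0 \text{ or } g(x)>0\}$. Relative log-concavity order: $X\leq_{lc}Y$ if $\mathrm{supp}(X)=\{x:f(x)>0\}$ and $\mathrm{supp}(Y)=\{x:g(x)>0\}$ are both intervals, $\mathrm{supp}(X)\subset\mathrm{supp}(Y)$,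 and $\log(f(x)/g(x))$ is concave on $\mathrm{supp}(X)$. The limits at $0$ exist in the extended reals by concavity. *)

(* Defs.v *)
From HB Require Import structures.
From mathcomp Require Import all_boot all_order all_algebra.
From mathcomp Require Import all_classical all_reals all_analysis.
Import Order.TTheory GRing.Theory Num.Theory numFieldNormedType.Exports.

Set Implicit Arguments.
Unset Strict Implicit.
Unset Printing Implicit Defensive.

Local Open Scope classical_set_scope.
Local Open Scope ring_scope.

Definition is_pdf d (T : measurableType d) (R : realType)
    (P : probability T R) (X : {RV P >-> R}) (f : R -> R) : Prop :=
  [/\ measurable_fun setT f,
      forall x, 0 <= f x &
      forall A : set R, measurable A ->
        distribution P X A = (\int[@lebesgue_measure R]_(x in A) (f x)%:E)%E].

Definition supp (R : realType) (f : R -> R) : set R := [set x | 0 < f x].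

Definition log_ratio (R : realType) (f g : R -> R) (x : R) : R :=
  ln (f x / g x).

Definition st_order (R : realType)
    d1 (T1 : measurableType d1) (P : probability T1 R) (X : {RV P >-> R})
    d2 (T2 : measurableType d2) (Q : probability T2 R) (Y : {RV Q >-> R}) :
    Prop :=
  forall x : R, (ccdf X x <= ccdf Y x)%E.

(* The hazard rate and reversed hazard rate orders are defined for variables
   with common support (0, +oo), on which the denominators are positive. *)
Definition hr_order (R : realType)
    d1 (T1 : measurableType d1) (P : probability T1 R) (X : {RV P >-> R})
    (f : R -> R)
    d2 (T2 : measurableType d2) (Q : probability T2 R) (Y : {RV Q >-> R})
    (g : R -> R) : Prop :=
  forall x : R, 0 < x -> ((g x)%:E / ccdf Y x <= (f x)%:E / ccdf X x)%E.

Definition rh_order (R : realType)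
    d1 (T1 : measurableType d1) (P : probability T1 R) (X : {RV P >-> R})
    (f : R -> R)
    d2 (T2 : measurableType d2) (Q : probability T2 R) (Y : {RV Q >-> R})
    (g : R -> R) : Prop :=
  forall x : R, 0 < x -> ((f x)%:E / cdf X x <= (g x)%:E / cdf Y x)%E.

(* The ratio is taken in [\bar R], where [c / 0 = +oo] for [c > 0], since [g]
   may vanish at points where [f] is positive. *)
Definition lr_order (R : realType) (f g : R -> R) : Prop :=
  {in supp f `|` supp g &, forall x y, x <= y ->
    ((f y)%:E / (g y)%:E <= (f x)%:E / (g x)%:E)%E}.

Definition concave_on (R : realType) (D : set R) (h : R -> R) : Prop :=
  convex_function (E := R^o) D (fun x => - h x : R^o).

Definition lc_order (R : realType) (f g : R -> R) : Prop :=
  [/\ is_interval (supp f), is_interval (supp g), supp f `<=` supp g &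
      concave_on (supp f) (log_ratio f g)].

(* Main.v *)
Require Import Defs.
From HB Require Import structures.
From mathcomp Require Import all_boot all_order all_algebra.
From mathcomp Require Import all_classical all_reals all_analysis.
From mathcomp Require Import measurable_realfun ring lra.
Import Order.TTheory GRing.Theory Num.Theory numFieldNormedType.Exports.

Set Implicit Arguments.
Unset Strict Implicit.
Unset Printing Implicit Defensive.

Local Open Scope classical_set_scope.
Local Open Scope ring_scope.

(** Write [l] for the log density ratio, so that [f = expR l * g] on ]0, +oo[.
    A pointwise bound on [l] over a set then becomes a bound on the ratio of the
    masses that [X] and [Y] give to that set, and every order becomes a
    condition on such masses or on [l] itself: with A_x = ]0, x] and
    B_x = ]x, +oo[,
    - st order says [mass X B_x <= mass Y B_x];
    - hr order says [mass X B_x <= expR (l x) * mass Y B_x];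
    - rh order says [expR (l x) * mass Y A_x <= mass X A_x];
    - lr order says that [l] is nonincreasing.

    Concavity enters through one fact ([concave_on_incr]): an increase of [l]
    between two points forces [l] to be strictly increasing before them.

    The st and hr orders. If the limit of [l] at 0 is negative, then [l < 0] on
    some ]0, b], so [X] gives less mass than [Y] to ]0, b] and more to the
    complementary ray, while [l b < 0]: both orders fail at [b]. If the limit is
    nonnegative, then for [0 < s <= t] either [0 <= l s] or [l t <= l s]
    ([concave_on_lim_ge0]). So for [0 <= l x] [l] is nonnegative on all of
    ]0, x], and comparing masses of ]0, x] and taking complements gives
    [mass X B_x <= mass Y B_x]; for [l x < 0] the value [l x] bounds [l] on the
    ray, and comparing masses of the ray gives
    [mass X B_x <= expR (l x) * mass Y B_x]. In each case the sign of [l x]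
    makes the bound obtained imply the other one ([lim_ge0_mass_ray]), hence
    both orders.

    The lr and rh orders. If [l] is nonincreasing then [l >= l x] on ]0, x],
    which is the rh order after integration. If [l x < l y] for some [x < y],
    then [l < l x] on ]0, x[ and the rh order fails at [x]. Finally the
    derivative of a concave function is nonincreasing, so its limit at 0 is its
    supremum, and this is nonpositive exactly when [l] is nonincreasing. *)

(** * Concave functions near the left end of a half-line *)

(** The chord inequality, cleared of denominators so that the uses below are
    linear arithmetic in the values of [h]. *)
Lemma concave_on_chord (R : realType) (D : set R) (h : R -> R) (x y z : R) :
  concave_on D h -> D x -> D z -> x < y -> y < z ->
  (z - y) * h x + (y - x) * h z <= (z - x) * h y.
Proof.
move=> hD Dx Dz xy yz.
have xz : 0 < z - x by rewrite subr_gt0 (lt_trans xy).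
have t01 : Itv.spec (@Itv.num_sem R) (Itv.Real `[0%Z, 1%Z]) ((z - y) / (z - x)).
  rewrite /= /Itv.num_sem/= num_real/= in_itv/= divr_ge0 ?subr_ge0 ?(ltW yz)//=;
    last exact/ltW/(lt_trans xy).
  by rewrite ler_pdivrMr// mul1r lerD2l lerN2 ltW.
(* [t] is the weight with [y = t * x + (1 - t) * z]. *)
set t := (z - y) / (z - x) in t01 *.
have tzx : t * (z - x) = z - y by rewrite divfK// gt_eqF.
have yE : t * x + (1 - t) * z = y.
  have -> : t * x + (1 - t) * z = z - t * (z - x) by ring.
  by rewrite tzx; ring.
have : - h (t * x + (1 - t) * z) <= t * - h x + (1 - t) * - h z.
  exact: (hD (Itv.mk t01) x z (mem_set Dx) (mem_set Dz)).
rewrite yE -(ler_pM2r xz).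
have -> : (t * - h x + (1 - t) * - h z) * (z - x) =
    - (t * (z - x) * h x) - (z - x - t * (z - x)) * h z by ring.
rewrite tzx; lra.
Qed.

(** The chord from [s] to [y] lies below the graph at [x], so [h x < h y] forces
    [h s < h x < h y]; then the same chord exceeds [h s] at [t]. *)
Lemma concave_on_incr (R : realType) (D : set R) (h : R -> R) (s t x y : R) :
  concave_on D h -> D s -> D y -> s < t -> t <= x -> x < y -> h x < h y ->
  h s < h t.
Proof.
move=> hD Ds Dy st tx xy hxy.
have hsx : h s < h x.
  have := concave_on_chord hD Ds Dy (lt_le_trans st tx) xy; nra.
have := concave_on_chord hD Ds Dy st (le_lt_trans tx xy); nra.
Qed.

(** A concave function is monotone near [a]: either it is nonincreasing
    everywhere, or it increases somewhere and hence all the way before. *)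
Lemma concave_on_cvg_at_right (R : realType) (a : R) (h : R -> R) :
  concave_on `]a, +oo[ h -> cvg ((h x)%:E @[x --> a^'+]).
Proof.
move=> hD.
have [hN|/existsNP[x /existsNP[y /not_implyP[ax /not_implyP[xy hxy]]]]] :=
  pselect (forall x y, a < x -> x <= y -> h y <= h x).
  apply: nonincreasing_at_right_is_cvge; near=> b => s t.
  by rewrite !in_itv/= lee_fin => /andP[? _] _; apply: hN.
apply: nondecreasing_at_right_is_cvge; near=> b => s t.
rewrite !in_itv/= => /andP[si _] /andP[ti tb] st; rewrite lee_fin.
move: st; rewrite le_eqVlt => /predU1P[->//|st].
move/negP: hxy; rewrite -ltNge => hxy.
have {}xy : x < y.
  by move: xy; rewrite le_eqVlt => /predU1P[xy|//]; rewrite xy ltxx in hxy.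
apply/ltW/(concave_on_incr hD _ _ st _ xy hxy); rewrite /= ?in_itv/= ?si//.
  by rewrite (lt_trans ax xy).
by rewrite (le_trans (ltW tb))//; near: b; exact: nbhs_right_le.
Unshelve. all: by end_near. Qed.

(** Quasi-concavity with one end sent to [a], where the value is at least 0: if
    [h s < 0] and [h s < h t] held, [h] would increase up to [s], so its limit
    would be at most [h s]. *)
Lemma concave_on_lim_ge0 (R : realType) (a : R) (h : R -> R) (s t : R) :
  concave_on `]a, +oo[ h -> (0 <= lim ((h x)%:E @[x --> a^'+]))%E ->
  a < s -> s <= t -> 0 <= h s \/ h t <= h s.
Proof.
move=> hD L0 as_ st; apply/orP; rewrite !leNgt -negb_and.
apply/negP => /andP[hs hst].
have {}st : s < t.
  by move: st; rewrite le_eqVlt => /predU1P[st|//]; rewrite st ltxx in hst.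
have : (lim ((h x)%:E @[x --> a^'+]) <= (h s)%:E)%E.
  apply: lime_le; first exact: concave_on_cvg_at_right.
  near=> r; rewrite lee_fin; apply/ltW.
  have rs : r < s by near: r; exact: nbhs_right_lt.
  apply: (concave_on_incr hD _ _ rs (lexx s) st hst);
    rewrite /= in_itv/= andbT; last exact: lt_trans st.
  by near: r; exact: nbhs_right_gt.
by move=> /(le_trans L0); rewrite lee_fin leNgt hs.
Unshelve. all: by end_near. Qed.

Lemma near_at_right_lim_lt0 (R : realType) (a : R) (h : R -> R) :
  cvg ((h x)%:E @[x --> a^'+]) -> (lim ((h x)%:E @[x --> a^'+]) < 0)%E ->
  exists2 b, a < b & forall x, a < x -> x <= b -> h x < 0.
Proof.
move=> hc L0.
have : \forall x \near a^'+, h x < 0.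
  have := hc _ (open_nbhs_nbhs (conj (@open_ereal_lt_ereal R 0%E) L0)).
  by move=> H; near=> x; rewrite -lte_fin; near: x; exact: H.
move=> [e /= e0 He].
(* Half the radius, so that the right end of the interval is included. *)
exists (a + e / 2) => [|x ax xb]; first by rewrite ltrDl divr_gt0.
apply: He => //=; rewrite ltr0_norm ?subr_lt0//; lra.
Unshelve. all: by end_near. Qed.

Lemma derive1_le_slope (R : realType) (h : R -> R) (x m : R) :
  derivable h x 1 ->
  (\forall z \near x^', (h z - h x) / (z - x) <= m) -> derive1 h x <= m.
Proof.
move=> dh [e /= e0 He].
apply: limr_le.
  by under eq_fun do rewrite -[X in h (X + x)]scaler1; exact: dh.
near=> d.
have d0 : d != 0 by near: d; exact: nbhs_dnbhs_neq.
have de : `|d| < e by near: d; exact: dnbhs0_lt.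
have := He (d + x).
rewrite /= addrK distrC addrK => /(_ de).
rewrite mulrC; apply.
by rewrite -subr_eq0 addrK.
Unshelve. all: by end_near. Qed.

Lemma derive1_ge_slope (R : realType) (h : R -> R) (x m : R) :
  derivable h x 1 ->
  (\forall z \near x^', m <= (h z - h x) / (z - x)) -> m <= derive1 h x.
Proof.
move=> dh H; rewrite -lerN2 -derive1N//; apply: derive1_le_slope.
  exact: derivableN.
by apply: filterS H => z; rewrite -opprD mulNr lerN2.
Qed.

(** The slope of the chord from [x] to [y] separates the two derivatives. *)
Lemma concave_on_derive1_nincr (R : realType) (a : R) (h : R -> R) :
  concave_on `]a, +oo[ h -> (forall x, a < x -> derivable h x 1) ->
  forall x y, a < x -> x <= y -> derive1 h y <= derive1 h x.
Proof.
move=> hD dh x y ax; rewrite le_eqVlt => /predU1P[->//|xy].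
have ay := lt_trans ax xy.
have D u : a < u -> [set` `]a, +oo[] u by rewrite /= in_itv/= andbT.
pose m := (h y - h x) / (y - x).
have mE : m * (y - x) = h y - h x by rewrite divfK// gt_eqF// subr_gt0.
apply: (@le_trans _ _ m).
  apply: derive1_le_slope; first exact: dh.
  near=> z.
  have zy : z != y by near: z; exact: nbhs_dnbhs_neq.
  have xz : x < z by near: z; apply: nbhs_dnbhs; exact: lt_nbhsr.
  have az := lt_trans ax xz.
  move: zy; rewrite neq_lt => /orP[zy|yz].
    rewrite ler_ndivrMr ?subr_lt0//.
    by have := concave_on_chord hD (D _ ax) (D _ ay) xz zy; nra.
  rewrite ler_pdivrMr ?subr_gt0//.
  by have := concave_on_chord hD (D _ ax) (D _ az) xy yz; nra.
apply: derive1_ge_slope; first exact: dh.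
near=> z.
have zx : z != x by near: z; exact: nbhs_dnbhs_neq.
have zy : z < y by near: z; apply: nbhs_dnbhs; exact: lt_nbhsl.
have az : a < z by near: z; apply: nbhs_dnbhs; exact: lt_nbhsr.
move: zx; rewrite neq_lt => /orP[zx|xz].
  rewrite ler_ndivlMr ?subr_lt0//.
  by have := concave_on_chord hD (D _ az) (D _ ay) zx xy; nra.
rewrite ler_pdivlMr ?subr_gt0//.
by have := concave_on_chord hD (D _ ax) (D _ ay) xz zy; nra.
Unshelve. all: by end_near. Qed.

Lemma concave_on_derive1_cvg_at_right (R : realType) (a : R) (h : R -> R) :
  concave_on `]a, +oo[ h -> (forall x, a < x -> derivable h x 1) ->
  cvg ((derive1 h x)%:E @[x --> a^'+]).
Proof.
move=> hD dh; apply: nonincreasing_at_right_is_cvge; near=> b => s t.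
rewrite !in_itv/= lee_fin => /andP[? _] _; exact: concave_on_derive1_nincr.
Unshelve. all: by end_near. Qed.

Lemma concave_on_derive1_lim_le0 (R : realType) (a : R) (h : R -> R) :
  concave_on `]a, +oo[ h -> (forall x, a < x -> derivable h x 1) ->
  (lim ((derive1 h x)%:E @[x --> a^'+]) <= 0)%E <->
  (forall x y, a < x -> x <= y -> h y <= h x).
Proof.
move=> hD dh; have hc := concave_on_derive1_cvg_at_right hD dh.
split => [L0|hN].
  have h'0 x : a < x -> derive1 h x <= 0.
    move=> ax; rewrite -lee_fin (le_trans _ L0)//; apply: lime_ge => //.
    near=> z; rewrite lee_fin; apply: concave_on_derive1_nincr => //.
    by near: z; exact: nbhs_right_le.
  move=> x y ax xy.
  apply: (@ler0_derive1_nincr _ h x y) => // [z|z|].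
  - by rewrite in_itv/= => /andP[xz _]; apply/dh/(lt_trans ax).
  - by rewrite in_itv/= => /andP[xz _]; apply/h'0/(lt_trans ax).
  - apply: derivable_within_continuous => z; rewrite in_itv/= => /andP[xz _].
    exact/dh/(lt_le_trans ax).
apply: lime_le => //; near=> x.
have ax : a < x by near: x; exact: nbhs_right_gt.
rewrite lee_fin; apply: derive1_le_slope; first exact: dh.
near=> z.
have az : a < z by near: z; apply: nbhs_dnbhs; exact: lt_nbhsr.
have [xz|zx|->] := ltgtP x z; last by rewrite !subrr mul0r.
  by rewrite pmulr_lle0 ?invr_gt0 ?subr_gt0// subr_le0 hN// ltW.
by rewrite nmulr_lle0 ?invr_lt0 ?subr_lt0// subr_ge0 hN// ltW.
Unshelve. all: by end_near. Qed.

(** * Comparing the masses of two densities *)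

(** Probabilities as real numbers, so that they are open to real arithmetic. *)
Definition mass d (T : measurableType d) (R : realType) (P : probability T R)
    (X : {RV P >-> R}) (A : set R) : R := fine (distribution P X A).

Lemma distribution_mass d (T : measurableType d) (R : realType)
    (P : probability T R) (X : {RV P >-> R}) (A : set R) :
  measurable A -> distribution P X A = (mass X A)%:E.
Proof. by move=> mA; rewrite /mass fineK// fin_num_measure. Qed.

Lemma mass_scale d (T : measurableType d) (R : realType) (P : probability T R)
    (X : {RV P >-> R}) (f : R -> R) (a : R) (A : set R) :
  is_pdf X f -> measurable A -> 0 <= a ->
  (a * mass X A)%:E = (\int[@lebesgue_measure R]_(x in A) (a * f x)%:E)%E.
Proof.
move=> [mf f0 Xf] mA a0.
rewrite EFinM -distribution_mass// Xf// -ge0_integralZl_EFin//.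
- by move=> x _; rewrite lee_fin.
- exact/measurable_EFinP/measurable_funTS.
Qed.

Lemma mass_le (R : realType)
    d1 (T1 : measurableType d1) (P : probability T1 R)
    d2 (T2 : measurableType d2) (Q : probability T2 R)
    (X : {RV P >-> R}) (Y : {RV Q >-> R}) (f g : R -> R) (a b : R) (A : set R) :
  is_pdf X f -> is_pdf Y g -> measurable A -> 0 <= a -> 0 <= b ->
  (forall x, A x -> a * f x <= b * g x) -> a * mass X A <= b * mass Y A.
Proof.
move=> fX gY mA a0 b0 fg; rewrite -lee_fin (mass_scale fX)// (mass_scale gY)//.
have [mf f0 _] := fX; have [mg g0 _] := gY.
apply: ge0_le_integral => //.
- by move=> x _; rewrite lee_fin mulr_ge0.
- by apply/measurable_EFinP/measurable_funM => //; exact: measurable_funTS.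
- by apply/measurable_EFinP/measurable_funM => //; exact: measurable_funTS.
Qed.

(** Strictness is asked on a part [B] of [A] only: in the reversed hazard rate
    order the strict bound on ]0, x] fails at [x] itself. Equality of the masses
    would make the nonnegative difference of the integrands vanish almost
    everywhere, hence make [B] negligible. *)
Lemma mass_lt (R : realType)
    d1 (T1 : measurableType d1) (P : probability T1 R)
    d2 (T2 : measurableType d2) (Q : probability T2 R)
    (X : {RV P >-> R}) (Y : {RV Q >-> R}) (f g : R -> R) (a b : R)
    (A B : set R) :
  is_pdf X f -> is_pdf Y g -> measurable A -> measurable B -> B `<=` A ->
  lebesgue_measure B != 0%E -> 0 <= a -> 0 <= b ->
  (forall x, A x -> a * f x <= b * g x) ->
  (forall x, B x -> a * f x < b * g x) -> a * mass X A < b * mass Y A.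
Proof.
move=> fX gY mA mB BA B0 a0 b0 fg fgB.
have [mf f0 _] := fX; have [mg g0 _] := gY.
have maf : measurable_fun A (fun x => a * f x).
  by apply: measurable_funM => //; exact: measurable_funTS.
have mbg : measurable_fun A (fun x => b * g x).
  by apply: measurable_funM => //; exact: measurable_funTS.
pose h x := ((b * g x - a * f x)%:E : \bar R).
have mh : measurable_fun A h by exact/measurable_EFinP/measurable_funB.
have h0 x : A x -> (0 <= h x)%E by move=> Ax; rewrite lee_fin subr_ge0 fg.
have bgE : (b * mass Y A)%:E =
    ((a * mass X A)%:E + \int[@lebesgue_measure R]_(x in A) h x)%E.
  rewrite (mass_scale fX)// (mass_scale gY)// -ge0_integralD//.
  - by apply: eq_integral => x _; rewrite /h -EFinD; congr EFin; lra.
  - by move=> x _; rewrite lee_fin mulr_ge0.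
  - exact/measurable_EFinP.
rewrite lt_neqAle (mass_le fX gY)// ?andbT.
apply/negP => /eqP ab.
have ih0 : (\int[@lebesgue_measure R]_(x in A) `|h x| = 0)%E.
  under eq_integral => x xA do rewrite gee0_abs ?(h0 _ (set_mem xA))//.
  move: bgE; rewrite ab.
  case: (\int[@lebesgue_measure R]_(x in A) h x)%E => [r|//|//].
  by rewrite -EFinD => -[r0]; congr EFin; lra.
have [N [mN N0 AN]] := (ae_eq_integral_abs (@lebesgue_measure R) mA mh).1 ih0.
move/eqP: B0; apply; apply: (subset_measure0 _ _ _ N0) => // x Bx.
apply: AN => /= /(_ (BA _ Bx)) [] /eqP.
by rewrite subr_eq0 gt_eqF// fgB.
Qed.

Lemma mass_gt0 d (T : measurableType d) (R : realType) (P : probability T R)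
    (X : {RV P >-> R}) (f : R -> R) (A : set R) :
  is_pdf X f -> measurable A -> lebesgue_measure A != 0%E ->
  A `<=` supp f -> 0 < mass X A.
Proof.
move=> fX mA A0 Af.
rewrite -(mul1r (mass X A)) -(mul0r (mass X A)).
by apply: (mass_lt fX fX mA mA) => // x /Af fx; rewrite mul0r mul1r// ltW.
Qed.

Lemma mass_eq_supp d (T : measurableType d) (R : realType) (P : probability T R)
    (X : {RV P >-> R}) (f : R -> R) (A B : set R) :
  is_pdf X f -> measurable A -> measurable B -> A `<=` B ->
  B `&` supp f `<=` A -> mass X B = mass X A.
Proof.
move=> fX mA mB AB BA; have [mf f0 Xf] := fX.
have BA0 : distribution P X (B `\` A) = 0%E.
  rewrite Xf; last exact: measurableD.
  apply: integral0_eq => x [Bx nAx]; congr EFin; apply/eqP/negPn/negP => fx0.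
  apply/nAx/BA; split => //; rewrite /supp /=.
  by rewrite lt_neqAle eq_sym f0 andbT.
congr fine; rewrite -(setDUK AB) measureU ?setDIK//; last exact: measurableD.
by rewrite -[RHS]adde0 -[in RHS]BA0.
Qed.

Section half_line.
Context d (T : measurableType d) (R : realType) (P : probability T R).
Variables (X : {RV P >-> R}) (f : R -> R).
Hypotheses (fX : is_pdf X f) (supp_f : supp f = `]0, +oo[%classic).

Lemma cdf_mass (x : R) : cdf X x = (mass X `]0, x])%:E.
Proof.
rewrite /cdf distribution_mass//; congr EFin; apply: (mass_eq_supp fX) => //.
- by move=> y /=; rewrite !in_itv/= => /andP[].
- by rewrite supp_f => y []/=; rewrite !in_itv/= andbT => -> ->.
Qed.

Lemma ccdf_mass (x : R) : ccdf X x = (mass X `]x, +oo[)%:E.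
Proof. by rewrite /ccdf distribution_mass. Qed.

Lemma mass_itvD (x : R) : mass X `]0, x] + mass X `]x, +oo[ = 1.
Proof.
by apply: EFin_inj; rewrite EFinD -cdf_mass -ccdf_mass cdf_ccdf_1.
Qed.

Lemma mass_itv_gt0 (x : R) : 0 < x -> 0 < mass X `]0, x].
Proof.
move=> x0; apply: (mass_gt0 fX) => //.
  by rewrite lebesgue_measure_itv/= lte_fin x0 sube0 eqe gt_eqF.
by rewrite supp_f => y /=; rewrite !in_itv/= => /andP[->].
Qed.

Lemma mass_ray_gt0 (x : R) : 0 < x -> 0 < mass X `]x, +oo[.
Proof.
move=> x0; apply: (mass_gt0 fX) => //.
  by rewrite lebesgue_measure_itv/= ltry.
by rewrite supp_f => y /=; rewrite !in_itv/= !andbT; exact: lt_trans.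
Qed.

End half_line.

Lemma log_ratioK (R : realType) (f g : R -> R) (x : R) :
  supp f x -> supp g x -> f x = expR (log_ratio f g x) * g x.
Proof.
move=> fx gx; rewrite /log_ratio lnK ?posrE ?divr_gt0//.
by rewrite divfK// gt_eqF.
Qed.

(** * The four orders in terms of the log density ratio *)

Section orders.
Context (R : realType).
Context d1 (T1 : measurableType d1) (P : probability T1 R).
Context d2 (T2 : measurableType d2) (Q : probability T2 R).
Variables (X : {RV P >-> R}) (Y : {RV Q >-> R}) (f g : R -> R).
Hypotheses (fX : is_pdf X f) (gY : is_pdf Y g).
Hypotheses (supp_f : supp f = `]0, +oo[%classic).
Hypotheses (supp_g : supp g = `]0, +oo[%classic).
Let l := log_ratio f g.

Let f_gt0 x : 0 < x -> 0 < f x.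
Proof. move=> x0; have : supp f x by rewrite supp_f /= in_itv/= x0.
exact. Qed.

Let g_gt0 x : 0 < x -> 0 < g x.
Proof. move=> x0; have : supp g x by rewrite supp_g /= in_itv/= x0.
exact. Qed.

Let fE x : 0 < x -> f x = expR (l x) * g x.
Proof. by move=> x0; apply: log_ratioK; [exact: f_gt0|exact: g_gt0]. Qed.

Lemma mass_log_ratio_le (c : R) (A : set R) : measurable A ->
  A `<=` `]0, +oo[ -> (forall t, A t -> l t <= c) ->
  mass X A <= expR c * mass Y A.
Proof.
move=> mA A0 Ac; rewrite -[leLHS]mul1r.
apply: (mass_le fX gY) => // t At.
have /= := A0 _ At; rewrite in_itv/= andbT => t0.
by rewrite mul1r fE// ler_pM2r ?g_gt0// ler_expR Ac.
Qed.

Lemma mass_log_ratio_ge (c : R) (A : set R) : measurable A ->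
  A `<=` `]0, +oo[ -> (forall t, A t -> c <= l t) ->
  expR c * mass Y A <= mass X A.
Proof.
move=> mA A0 Ac; rewrite -[leRHS]mul1r.
apply: (mass_le gY fX) => // t At.
have /= := A0 _ At; rewrite in_itv/= andbT => t0.
by rewrite mul1r fE// ler_pM2r ?g_gt0// ler_expR Ac.
Qed.

Lemma mass_log_ratio_lt (c x : R) : 0 < x ->
  (forall t, 0 < t -> t < x -> l t < c) -> l x <= c ->
  mass X `]0, x] < expR c * mass Y `]0, x].
Proof.
move=> x0 ltc lxc; rewrite -[ltLHS]mul1r.
have lc t : 0 < t -> t <= x -> l t <= c.
  by move=> t0; rewrite le_eqVlt => /predU1P[->//|tx]; exact/ltW/ltc.
apply: (mass_lt fX gY (B := `]0, x[)) => //.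
- by move=> t /=; rewrite !in_itv/= => /andP[-> /ltW].
- by rewrite lebesgue_measure_itv/= lte_fin x0 sube0 eqe gt_eqF.
- move=> t /=; rewrite in_itv/= => /andP[t0 tx].
  by rewrite mul1r fE// ler_pM2r ?g_gt0// ler_expR lc.
- move=> t /=; rewrite in_itv/= => /andP[t0 tx].
  by rewrite mul1r fE// ltr_pM2r ?g_gt0// ltr_expR ltc.
Qed.

Lemma hr_orderP : hr_order X f Y g <->
  forall x, 0 < x -> mass X `]x, +oo[ <= expR (l x) * mass Y `]x, +oo[.
Proof.
suff E x : 0 < x -> ((g x)%:E / ccdf Y x <= (f x)%:E / ccdf X x)%E =
    (mass X `]x, +oo[ <= expR (l x) * mass Y `]x, +oo[).
  by split=> H x x0; have := H x x0; rewrite E.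
move=> x0; have mX := mass_ray_gt0 fX supp_f x0.
have mY := mass_ray_gt0 gY supp_g x0.
rewrite !ccdf_mass !inver !gt_eqF// -!EFinM lee_fin.
rewrite ler_pdivrMr// mulrAC ler_pdivlMr// fE// mulrC mulrAC.
by rewrite ler_pM2r// g_gt0.
Qed.

Lemma rh_orderP : rh_order X f Y g <->
  forall x, 0 < x -> expR (l x) * mass Y `]0, x] <= mass X `]0, x].
Proof.
suff E x : 0 < x -> ((f x)%:E / cdf X x <= (g x)%:E / cdf Y x)%E =
    (expR (l x) * mass Y `]0, x] <= mass X `]0, x]).
  by split=> H x x0; have := H x x0; rewrite E.
move=> x0; have mX := mass_itv_gt0 fX supp_f x0.
have mY := mass_itv_gt0 gY supp_g x0.
rewrite (cdf_mass fX)// (cdf_mass gY)// !inver !gt_eqF// -!EFinM lee_fin.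
rewrite ler_pdivrMr// mulrAC ler_pdivlMr// fE// mulrAC [leRHS]mulrC.
by rewrite ler_pM2r// g_gt0.
Qed.

Lemma lr_orderP : lr_order f g <->
  forall x y, 0 < x -> x <= y -> l y <= l x.
Proof.
have E x y : 0 < x -> 0 < y ->
    ((f y)%:E / (g y)%:E <= (f x)%:E / (g x)%:E)%E = (l y <= l x).
  move=> x0 y0; have [fx fy] := (f_gt0 x0, f_gt0 y0).
  have [gx gy] := (g_gt0 x0, g_gt0 y0).
  rewrite !inver !gt_eqF// -!EFinM lee_fin /l /log_ratio.
  by rewrite ler_ln ?posrE ?divr_gt0.
have S x : (x \in supp f `|` supp g) = (0 < x).
  by rewrite supp_f supp_g setUid mem_setE in_itv/= andbT.
split=> [H x y x0 xy|H x y].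
  by rewrite -E ?(lt_le_trans x0)//; apply: H; rewrite ?S// (lt_le_trans x0).
by rewrite !S => x0 y0 xy; rewrite E// H.
Qed.

Lemma st_orderP : st_order X Y <->
  forall x, 0 < x -> mass X `]x, +oo[ <= mass Y `]x, +oo[.
Proof.
split=> [H x x0|H x]; first by rewrite -lee_fin -!ccdf_mass.
have [x0|x0] := ltP 0 x; first by rewrite !ccdf_mass lee_fin H.
(* Left of 0 the tail of [Y] is full, since ]0, x] is empty. *)
have -> : ccdf Y x = 1%E.
  rewrite ccdf_1_cdf (cdf_mass gY)// set_itv_ge ?bnd_simp -?leNgt//.
  by rewrite /mass measure0 sube0.
exact: probability_le1.
Qed.

(** * The limits at the origin *)

(** One witness refutes both the usual stochastic and the hazard rate order. *)
Lemma lt_mass_ray_lim_lt0 : concave_on `]0, +oo[ l ->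
  (lim ((l x)%:E @[x --> 0^'+]) < 0)%E ->
  exists x, [/\ 0 < x, l x < 0 & mass Y `]x, +oo[ < mass X `]x, +oo[].
Proof.
move=> hl /(near_at_right_lim_lt0 (concave_on_cvg_at_right hl))[b b0 lb].
exists b; split => //; first exact: lb.
have : mass X `]0, b] < mass Y `]0, b].
  rewrite -[ltRHS]mul1r -expR0; apply: mass_log_ratio_lt => //.
    by move=> t t0 /ltW; exact: lb.
  by rewrite ltW// lb.
have := mass_itvD fX supp_f b; have := mass_itvD gY supp_g b; lra.
Qed.

(** The sign of [l x] decides on which side of [x] the ratio is controlled: on
    the left, where [l >= 0], or on the right, where [l <= l x]. In either case
    the stated bound is the stronger of the two that the orders require. *)
Lemma lim_ge0_mass_ray : concave_on `]0, +oo[ l ->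
  (0 <= lim ((l x)%:E @[x --> 0^'+]))%E -> forall x, 0 < x ->
  (0 <= l x /\ mass X `]x, +oo[ <= mass Y `]x, +oo[) \/
  (l x < 0 /\ mass X `]x, +oo[ <= expR (l x) * mass Y `]x, +oo[).
Proof.
move=> hl L0 x x0; have [lx|lx] := leP 0 (l x); [left|right]; split => //.
  have : mass Y `]0, x] <= mass X `]0, x].
    rewrite -[leLHS]mul1r -expR0; apply: mass_log_ratio_ge => //.
      by move=> t /=; rewrite !in_itv/= => /andP[->].
    move=> t /=; rewrite in_itv/= => /andP[t0 tx].
    by have [//|] := concave_on_lim_ge0 hl L0 t0 tx; exact: le_trans.
  have := mass_itvD fX supp_f x; have := mass_itvD gY supp_g x; lra.
apply: mass_log_ratio_le => //.
  by move=> t /=; rewrite !in_itv/= !andbT; exact: lt_trans.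
move=> t /=; rewrite in_itv/= andbT => /ltW xt.
by have [|//] := concave_on_lim_ge0 hl L0 x0 xt; rewrite leNgt lx.
Qed.

Lemma st_order_lim : concave_on `]0, +oo[ l ->
  st_order X Y <-> (0 <= lim ((l x)%:E @[x --> 0^'+]))%E.
Proof.
move=> hl; rewrite st_orderP; split=> [st|L0 x x0].
  rewrite leNgt; apply/negP => /(lt_mass_ray_lim_lt0 hl)[x [x0 _]].
  by rewrite ltNge st.
have [[]//|[lx]] := lim_ge0_mass_ray hl L0 x0.
move=> /le_trans; apply; rewrite ler_piMl ?fine_ge0//.
by rewrite -expR0 ler_expR ltW.
Qed.

Lemma hr_order_lim : concave_on `]0, +oo[ l ->
  hr_order X f Y g <-> (0 <= lim ((l x)%:E @[x --> 0^'+]))%E.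
Proof.
move=> hl; rewrite hr_orderP; split=> [hr|L0 x x0].
  rewrite leNgt; apply/negP => /(lt_mass_ray_lim_lt0 hl)[x [x0 lx YX]].
  have := lt_le_trans YX (hr x x0); rewrite ltNge ler_piMl ?fine_ge0//.
  by rewrite -expR0 ler_expR ltW.
have [[lx XY]|[]//] := lim_ge0_mass_ray hl L0 x0.
apply: (le_trans XY); rewrite ler_peMl ?fine_ge0//.
by rewrite -expR0 ler_expR.
Qed.

(** Failure of monotonicity at [x < y] makes [l] strictly smaller than [l x]
    on ]0, x[, which contradicts the reversed hazard rate inequality at [x]. *)
Lemma rh_order_nincr : concave_on `]0, +oo[ l ->
  rh_order X f Y g <-> forall x y, 0 < x -> x <= y -> l y <= l x.
Proof.
move=> hl; rewrite rh_orderP; split=> [rh x y x0 xy|ln x x0]; last first.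
  apply: mass_log_ratio_ge => //.
    by move=> t /=; rewrite !in_itv/= => /andP[->].
  by move=> t /=; rewrite in_itv/= => /andP[]; exact: ln.
rewrite leNgt; apply/negP => lxy.
have {}xy : x < y.
  by move: xy; rewrite le_eqVlt => /predU1P[xy|//]; rewrite xy ltxx in lxy.
have : mass X `]0, x] < expR (l x) * mass Y `]0, x].
  apply: mass_log_ratio_lt => // t t0 tx.
  apply: (concave_on_incr hl _ _ tx (lexx x) xy lxy);
    rewrite /= in_itv/= andbT//.
  exact: lt_trans xy.
by rewrite ltNge rh.
Qed.

End orders.

Theorem theorem1 (R : realType)
    (d1 : measure_display) (T1 : measurableType d1) (P : probability T1 R)
    (d2 : measure_display) (T2 : measurableType d2) (Q : probability T2 R)
    (X : {RV P >-> R}) (Y : {RV Q >-> R}) (f g : R -> R)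
    (fX : is_pdf X f) (gY : is_pdf Y g)
    (supp_f : supp f = `]0, +oo[%classic) (supp_g : supp g = `]0, +oo[%classic)
    (l := log_ratio f g)
    (l_cont : forall x : R, 0 < x -> {for x, continuous l})
    (XY_lc : lc_order f g) :
  [/\ cvg ((l x)%:E @[x --> 0^'+]),
      st_order X Y <-> hr_order X f Y g,
      st_order X Y <-> (0 <= lim ((l x)%:E @[x --> 0^'+]))%E &
      hr_order X f Y g <-> (0 <= lim ((l x)%:E @[x --> 0^'+]))%E]
  /\
  ((forall x : R, 0 < x -> derivable l x 1) ->
   (forall x : R, 0 < x -> {for x, continuous (derive1 l)}) ->
   [/\ cvg ((derive1 l x)%:E @[x --> 0^'+]),
       lr_order f g <-> rh_order X f Y g,
       lr_order f g <-> (lim ((derive1 l x)%:E @[x --> 0^'+]) <= 0)%E &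
       rh_order X f Y g <-> (lim ((derive1 l x)%:E @[x --> 0^'+]) <= 0)%E]).
Proof.
have hl : concave_on `]0, +oo[ l by case: XY_lc => _ _ _; rewrite supp_f.
have st := st_order_lim fX gY supp_f supp_g hl.
have hr := hr_order_lim fX gY supp_f supp_g hl.
split; first by split=> //; [exact: concave_on_cvg_at_right|rewrite st hr].
move=> dl _.
have lr := lr_orderP supp_f supp_g.
have rh := rh_order_nincr fX gY supp_f supp_g hl.
have L' := concave_on_derive1_lim_le0 hl dl.
split; first exact: concave_on_derive1_cvg_at_right.
- by rewrite lr rh.
- by rewrite lr L'.
- by rewrite rh L'.
Qed.
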